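(* Let $v\ge4$. As formal power series in $y$, \[1+\sum_{d=1}^\infty \sum_{D \in \mathcal{D}_{v,d}(132,213)} x^{des(\pi_D)}y^d = \frac{1-yx}{1-y(1+x)}.\]
   Context: A diamond with $v$ vertices ($v\ge4$) is the poset with a least element, a greatest element, and $v-2$ pairwise incomparable middle elements (in a fixed left-to-right order) strictly between them. $\mathcal{D}_{v,d}$ is the set of labellings of $d$ diamonds (placed left to right) by $1,\dots,vd$, each label used once, such that in each diamond least label $<$ each middle label $<$ greatest label. For $D\in\mathcal{D}_{v,d}$, $\pi_D$ is the permutation obtained by reading the diamonds left to right and, within each diamond, the least element, then the middle elements left to right, then the greatest element. $\mathcal{D}_{v,d}(P)$ is the set of $D$ with $\pi_D$ avoiding every classical pattern in $P$. $des(\pi)$ is the number of $i$ with $\pi_i>\pi_{i+1}$. *)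

(* Defs.v *)
From HB Require Import structures.
From mathcomp Require Import all_boot all_order all_algebra.
From mathcomp Require Import boolp.

Set Implicit Arguments.
Unset Strict Implicit.
Unset Printing Implicit Defensive.

Import GRing.Theory.
Local Open Scope ring_scope.

Record fps (R : Type) := Fps { fcoef : nat -> R }.

HB.instance Definition _ (R : Type) := gen_eqMixin (fps R).
HB.instance Definition _ (R : Type) := gen_choiceMixin (fps R).

Lemma fpsP (R : Type) (a b : fps R) : (forall n, fcoef a n = fcoef b n) <-> a = b.
Proof.
split=> [|-> //]; case: a b => [a] [b] /= ab.
by congr Fps; apply: funext.
Qed.

Section FpsRing.
Variable R : comUnitRingType.
Implicit Types a b c : fps R.

Definition fps_zero : fps R := Fps (fun=> 0).
Definition fps_opp a : fps R := Fps (fun n => - fcoef a n).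
Definition fps_add a b : fps R := Fps (fun n => fcoef a n + fcoef b n).

Fact fps_addA : associative fps_add.
Proof. by move=> a b c; apply/fpsP => n /=; rewrite addrA. Qed.
Fact fps_addC : commutative fps_add.
Proof. by move=> a b; apply/fpsP => n /=; rewrite addrC. Qed.
Fact fps_add0 : left_id fps_zero fps_add.
Proof. by move=> a; apply/fpsP => n /=; rewrite add0r. Qed.
Fact fps_addN : left_inverse fps_zero fps_opp fps_add.
Proof. by move=> a; apply/fpsP => n /=; rewrite addNr. Qed.

HB.instance Definition _ :=
  GRing.isZmodule.Build (fps R) fps_addA fps_addC fps_add0 fps_addN.

Definition fpsC (r : R) : fps R := Fps (fun n => if n == 0%N then r else 0).
Definition fpsX : fps R := Fps (fun n => (n == 1%N)%:R).
Definition fps_mul a b : fps R :=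
  Fps (fun n => \sum_(i < n.+1) fcoef a i * fcoef b (n - i)%N).

Definition fps_trunc n a : {poly R} := \poly_(i < n) fcoef a i.

Fact fcoef_mul_trunc n m a b : (n < m)%N ->
  fcoef (fps_mul a b) n = (fps_trunc m a * fps_trunc m b)`_n.
Proof.
move=> nm; rewrite coefM; apply: eq_bigr => i _.
have im : (i < m)%N := leq_trans (ltn_ord i) nm.
by rewrite !coef_poly im (leq_ltn_trans (leq_subr i n) nm).
Qed.

Fact fps_mulC : commutative fps_mul.
Proof.
by move=> a b; apply/fpsP => n; rewrite !(@fcoef_mul_trunc _ n.+1)// mulrC.
Qed.

Fact fps_mulA : associative fps_mul.
Proof.
move=> a b c; apply/fpsP => n.
transitivity ((fps_trunc n.+1 a * (fps_trunc n.+1 b * fps_trunc n.+1 c))`_n).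
  rewrite coefM; apply: eq_bigr => i _.
  rewrite (@fcoef_mul_trunc _ n.+1) ?ltnS ?leq_subr //.
  by rewrite coef_poly ltn_ord.
rewrite mulrA coefM; apply: eq_bigr => i _.
rewrite (@fcoef_mul_trunc _ n.+1) //.
by rewrite [in LHS]coef_poly ltnS leq_subr.
Qed.

Fact fps_mul1 : left_id (fpsC 1) fps_mul.
Proof.
move=> a; apply/fpsP => n /=; rewrite big_ord_recl /= mul1r subn0.
by rewrite big1 ?addr0 // => i _; rewrite mul0r.
Qed.

Fact fps_mulD : left_distributive fps_mul fps_add.
Proof.
move=> a b c; apply/fpsP => n /=; rewrite -big_split; apply: eq_bigr => i _.
by rewrite mulrDl.
Qed.

Fact fps_one_neq0 : fpsC 1 != 0.
Proof. by apply/eqP => /fpsP /(_ 0%N) /= /eqP; rewrite oner_eq0. Qed.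

HB.instance Definition _ :=
  GRing.Zmodule_isComNzRing.Build (fps R)
    fps_mulA fps_mulC fps_mul1 fps_mulD fps_one_neq0.

(* The first n coefficients of a^-1, obtained by solving a * a^-1 = 1 degree  *)
(* by degree.                                                                 *)
Fixpoint fps_inv_seq a n : seq R :=
  if n is m.+1 then
    let s := fps_inv_seq a m in
    rcons s ((fcoef a 0)^-1 *
             ((m == 0%N)%:R - \sum_(k < m) fcoef a (m - k)%N * s`_k))
  else [::].

Definition fps_unit : pred (fps R) := fun a => fcoef a 0 \is a GRing.unit.

(* As for any unitRingType, the inverse of a non-unit is itself.              *)
Definition fps_inv a : fps R :=
  if fps_unit a then Fps (fun n => (fps_inv_seq a n.+1)`_n) else a.

Fact size_fps_inv_seq a n : size (fps_inv_seq a n) = n.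
Proof. by elim: n => //= n IHn; rewrite size_rcons IHn. Qed.

Fact nth_fps_inv_seq a n k : (k < n)%N ->
  (fps_inv_seq a n)`_k = (fps_inv_seq a k.+1)`_k.
Proof.
elim: n => // n IHn; rewrite ltnS leq_eqVlt => /predU1P[-> // | kn].
by rewrite -IHn //= nth_rcons size_fps_inv_seq kn.
Qed.

Fact fps_mulV : {in fps_unit, left_inverse 1 fps_inv *%R}.
Proof.
move=> a Ua; rewrite mulrC; apply/fpsP => n.
rewrite /fps_inv (Ua : fps_unit a); set b := Fps _.
have -> : fcoef (a * b) n = \sum_(k < n.+1) fcoef a (n - k)%N * fcoef b k.
  rewrite mulrC /=; apply: eq_bigr => i _; exact: mulrC.
rewrite big_ord_recr /= subnn nth_rcons size_fps_inv_seq ltnn eqxx.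
rewrite mulrA mulrV // mul1r.
under [X in X + _]eq_bigr => k _ do
  rewrite -/(fps_inv_seq a k.+1) -(nth_fps_inv_seq a (ltn_ord k)).
by rewrite addrC subrK; case: n.
Qed.

Fact fps_unitPl a b : b * a = 1 -> fps_unit a.
Proof.
move=> /fpsP /(_ 0%N) /=; rewrite big_ord1 /= => ba.
by apply/unitrP; exists (fcoef b 0); split=> //; rewrite mulrC.
Qed.

Fact fps_inv_out : {in [predC fps_unit], fps_inv =1 id}.
Proof. by move=> a; rewrite inE /fps_inv => /negbTE Ua; rewrite [fps_unit a]Ua. Qed.

HB.instance Definition _ :=
  GRing.ComNzRing_hasMulInverse.Build (fps R) fps_mulV fps_unitPl fps_inv_out.

End FpsRing.

Local Open Scope nat_scope.

Definition order_iso (s t : seq nat) : bool :=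
  (size s == size t) &&
  [forall i : 'I_(size s), forall j : 'I_(size s),
     (nth 0 s i < nth 0 s j) == (nth 0 t i < nth 0 t j)].

Definition contains (w p : seq nat) : bool :=
  [exists m : (size w).-tuple bool, order_iso (mask m w) p].

Definition avoids (w : seq nat) (P : seq (seq nat)) : bool :=
  all (fun p => ~~ contains w p) P.

Definition des (w : seq nat) : nat :=
  #|[set i : 'I_(size w).-1 | nth 0 w i.+1 < nth 0 w i]|.

(* The strict order of the diamond on 'I_v: 0 is the least element, v.-1 the  *)
(* greatest one, and 1, ..., v - 2 are the middle elements from left to right.*)
Definition diamond_lt (v : nat) : rel 'I_v :=
  fun i j => (i != j) && ((val i == 0) || (val j == v.-1)).

(* D (k, i) is the label of the element i of the k-th diamond from the left;  *)
(* l : 'I_(v * d) stands for the label l.+1. An injective D uses every label  *)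
(* exactly once, since its domain also has v * d elements.                    *)
Definition diamonds (v d : nat) : {set {ffun 'I_d * 'I_v -> 'I_(v * d)}} :=
  [set D : {ffun 'I_d * 'I_v -> 'I_(v * d)} | injectiveb D &&
    [forall k : 'I_d, forall i : 'I_v, forall j : 'I_v,
       diamond_lt i j ==> (D (k, i) < D (k, j))]].

Definition diamond_word (v d : nat) (D : {ffun 'I_d * 'I_v -> 'I_(v * d)}) :
    seq nat :=
  [seq (val (D (k, i))).+1 | k <- enum 'I_d, i <- enum 'I_v].

Definition diamonds_avoiding (v d : nat) (P : seq (seq nat)) :
    {set {ffun 'I_d * 'I_v -> 'I_(v * d)}} :=
  [set D in diamonds v d | avoids (diamond_word D) P].

(* Main.v *)
(** A permutation avoids 132 and 213 iff it is a decreasing sequence of blocks,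
    each block increasing; such a permutation is determined by its descent set,
    since an earlier entry is smaller than a later one iff no descent separates
    them. A descent inside a diamond is impossible because the least label comes
    first and the greatest last, so the descents occur only between consecutive
    diamonds, and there they can be prescribed freely. Hence d diamonds
    contribute (1 + x)^(d - 1). *)

Require Import Defs.
From HB Require Import structures.
From mathcomp Require Import all_boot all_order all_algebra.
From mathcomp Require Import zify.

Import GRing.Theory.
Local Open Scope ring_scope.

(** * Words avoiding 132 and 213, and how descents govern their order *)

Section Words.
Local Open Scope nat_scope.

Lemma nth_allpairs (S T R : Type) (f : S -> T -> R) (x0 : S) (y0 : T) (z0 : R)
    (s : seq S) (t : seq T) (i j : nat) :
  i < size s -> j < size t ->
  nth z0 [seq f x y | x <- s, y <- t] (i * size t + j) =
  f (nth x0 s i) (nth y0 t j).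
Proof.
move=> + jt; elim: s i => [|x s IHs] [|i] //= si; rewrite nth_cat size_map.
  by rewrite mul0n add0n jt (nth_map y0).
rewrite mulSn -addnA ltnNge leq_addr /= addKn; exact: IHs.
Qed.

(** A mask amounts to the increasing list of positions it keeps, obtained by applying it to
    [iota 0 (size w)]. *)
Lemma containsP (w p : seq nat) :
  reflect (exists s, [/\ sorted ltn s, all (fun i => i < size w) s
                       & order_iso [seq nth 0 w i | i <- s] p])
          (contains w p).
Proof.
have wE : w = [seq nth 0 w i | i <- iota 0 (size w)] by rewrite map_nth_iota0 ?take_size.
apply: (iffP existsP) => [[m iso] | [s [s_sorted s_lt iso]]].
  exists (mask m (iota 0 (size w))); split.
  - exact: (sorted_mask ltn_trans _ (iota_ltn_sorted 0 _)).
  - by apply/allP => i /mem_mask; rewrite mem_iota.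
  - by rewrite map_mask -wE.
have /subseqP[m sz_m sE] : subseq s (iota 0 (size w)).
  (* An increasing sequence is determined by its set of entries. *)
  have -> : s = filter (mem s) (iota 0 (size w)).
    apply: (irr_sorted_eq ltn_trans ltnn) => //.
      exact/(sorted_filter ltn_trans)/iota_ltn_sorted.
    move=> i; rewrite mem_filter mem_iota /=.
    by apply/idP/andP => [si | []] //; rewrite si (allP s_lt).
  exact: filter_subseq.
rewrite size_iota in sz_m.
exists (tcast sz_m (in_tuple m)).
by rewrite val_tcast /= [X in mask _ X]wE -map_mask -sE.
Qed.

(** The first conjunct excludes 132 and the second 213 at the positions [i < j < k]. *)
Definition reverse_layered (n : nat) (f : nat -> nat) : Prop :=
  forall i j k, i < j -> j < k -> k < n ->
  ~~ (f i < f k < f j) && ~~ (f j < f i < f k).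

Lemma order_iso3 (a b c a' b' c' : nat) :
  order_iso [:: a; b; c] [:: a'; b'; c'] =
  [&& (a < b) == (a' < b'), (a < c) == (a' < c'), (b < a) == (b' < a'),
      (b < c) == (b' < c'), (c < a) == (c' < a') & (c < b) == (c' < b')].
Proof.
rewrite /order_iso eqxx /=; apply/forallP/idP => [h | h i].
  have h2 i j (i3 : i < 3) (j3 : j < 3) := forallP (h (Ordinal i3)) (Ordinal j3).
  apply/and5P; split; [exact: (h2 0 1 isT isT) | exact: (h2 0 2 isT isT)
    | exact: (h2 1 0 isT isT) | exact: (h2 1 2 isT isT) |].
  by apply/andP; split; [exact: (h2 2 0 isT isT) | exact: (h2 2 1 isT isT)].
case/and5P: h => h1 h2 h3 h4 /andP[h5 h6]; apply/forallP => j.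
by move: i j => [] [|[|[|i]]] // ? [] [|[|[|j]]] // ? /=; rewrite ?ltnn.
Qed.

Lemma contains3P (w : seq nat) (a b c : nat) :
  reflect (exists i j k, [/\ i < j, j < k, k < size w &
             order_iso [:: nth 0 w i; nth 0 w j; nth 0 w k] [:: a; b; c]])
          (contains w [:: a; b; c]).
Proof.
apply: (iffP (containsP _ _)) => [[s [s_sorted s_lt iso]]|].
  have /eqP := proj1 (andP iso); rewrite size_map /=.
  case: s s_sorted s_lt iso => [|i [|j [|k [|]]]] //= /and3P[ij jk _] /and4P[_ _ kw _] iso _.
  by exists i, j, k.
move=> [i [j [k [ij jk kw iso]]]]; exists [:: i; j; k]; split=> //=.
  by rewrite ij jk.
by rewrite kw (ltn_trans jk kw) (ltn_trans ij (ltn_trans jk kw)).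
Qed.

Lemma avoids_132_213P (w : seq nat) :
  reflect (reverse_layered (size w) (nth 0 w))
          (avoids w [:: [:: 1; 3; 2]; [:: 2; 1; 3]]).
Proof.
rewrite /avoids /= andbT; apply: (iffP andP) => [[h1 h2] i j k ij jk kw | h].
  apply/andP; split; apply/negP => /andP[lt1 lt2].
    case/contains3P: h1; exists i, j, k; split=> //; rewrite order_iso3 /=; lia.
  case/contains3P: h2; exists i, j, k; split=> //; rewrite order_iso3 /=; lia.
by split; apply/contains3P => -[i [j [k [ij jk kw]]]]; rewrite order_iso3 /=;
  have := h _ _ _ ij jk kw; lia.
Qed.

(** A descent between [i] and [j] together with [f i < f j] would create 132 or 213; without
    descents the values climb step by step from [i] to [j]. *)
Lemma reverse_layered_ltn (n : nat) (f : nat -> nat) (i j : nat) :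
  (forall p q, p < n -> q < n -> f p = f q -> p = q) ->
  reverse_layered n f -> i < j -> j < n ->
  (f i < f j) = ~~ has (fun k => f k.+1 < f k) (index_iota i j).
Proof.
move=> inj_f rl ij jn; apply/idP/hasPn => [fij k | nodes].
  rewrite mem_index_iota => /andP[ik kj]; apply/negP => des_k.
  have neq p q : p < q -> q < n -> f p <> f q.
    by move=> pq qn fE; have := inj_f _ _ (ltn_trans pq qn) qn fE; lia.
  have [ki | ik'] := eqVneq i k.
    subst k; have [? | ?] := eqVneq i.+1 j; first by subst j; lia.
    have := rl i i.+1 j; lia.
  have [? | k1j] := eqVneq k.+1 j.
    subst j; have := rl i k k.+1; lia.
  (* Here [i < k] and [k.+1 < j]. If [f j < f k], then [i, k, j] form 132; otherwise [k, k.+1, j]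
     form 213. *)
  have := rl i k k.+1; have := rl k k.+1 j; have := rl i k j.
  have := neq i k; have := neq i k.+1; have := neq k j; lia.
elim: j ij jn nodes => // j IHj; rewrite ltnS leq_eqVlt => /predU1P[<- | ij] jn nodes.
  have := nodes i; have := inj_f i i.+1; rewrite mem_index_iota; lia.
apply: (@ltn_trans (f j)).
  apply: IHj => //; first by lia.
  by move=> k; rewrite mem_index_iota => kij; apply: nodes; rewrite mem_index_iota; lia.
have := nodes j; have := inj_f j j.+1; rewrite mem_index_iota; lia.
Qed.

Lemma reverse_layered_same_order (n : nat) (f g : nat -> nat) :
  (forall p q, p < n -> q < n -> f p = f q -> p = q) ->
  (forall p q, p < n -> q < n -> g p = g q -> p = q) ->
  reverse_layered n f -> reverse_layered n g ->
  (forall k, k.+1 < n -> (f k.+1 < f k) = (g k.+1 < g k)) ->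
  forall i j, i < n -> j < n -> (f i < f j) = (g i < g j).
Proof.
move=> injf injg rlf rlg same.
have lt i j : i < j -> j < n -> (f i < f j) = (g i < g j).
  move=> ij jn; rewrite (@reverse_layered_ltn n f) // (@reverse_layered_ltn n g) //.
  congr (~~ _); apply: eq_in_has => k; rewrite mem_index_iota => kij.
  by apply: same; lia.
move=> i j i_n j_n; have [/lt -> // | ji | ->] := ltngtP i j; last by rewrite !ltnn.
have := lt _ _ ji i_n; have := injf i j i_n j_n; have := injg i j i_n j_n; lia.
Qed.

End Words.

(** * Labels as ranks *)

Section Ranks.
Local Open Scope nat_scope.

Lemma card_ord_ltn (n m : nat) : m <= n -> #|[set x : 'I_n | x < m]| = m.
Proof.
move=> mn; rewrite -sum1_card (eq_bigl (fun x : 'I_n => x < m)).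
  by rewrite -(big_ord_widen n (fun=> 1)) // sum1_card card_ord.
by move=> x; rewrite inE.
Qed.

(** Equal cardinalities make [D] bijective, so each label below [D t] is attained exactly once.
    Labels can thus be recovered from comparisons alone. *)
Lemma injective_rankE (T : finType) (n : nat) (D : T -> 'I_n) (t : T) :
  #|T| = n -> injective D -> #|[set u | D u < D t]| = D t.
Proof.
move=> cardT injD; rewrite -[RHS](@card_ord_ltn n) 1?ltnW //.
rewrite -(card_imset _ injD); congr #|pred_of_set _|.
have [g gK Kg] := inj_card_bij injD (eq_leq (etrans (card_ord n) (esym cardT))).
apply/setP => x; rewrite inE; apply/imsetP/idP => [[u] | xt].
  by rewrite inE => + ->.
by exists (g x); rewrite ?inE Kg.
Qed.

Lemma injective_same_order (T : finType) (n : nat) (D E : T -> 'I_n) :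
  #|T| = n -> injective D -> injective E ->
  (forall t u, (D t < D u) = (E t < E u)) -> D =1 E.
Proof.
move=> cardT injD injE same t; apply: val_inj.
rewrite /= -(@injective_rankE T n D) // -(@injective_rankE T n E) //.
by apply: eq_card => u; rewrite !inE same.
Qed.

(** Standardization: each element is labelled by the number of elements with a smaller key. *)
Lemma rank_exists (T : finType) (n : nat) (key : T -> nat) :
  #|T| = n -> injective key ->
  exists2 D : {ffun T -> 'I_n}, injective D &
    forall t u, (D t < D u) = (key t < key u).
Proof.
move=> cardT inj_key; pose r t := #|[set u | key u < key t]|.
have r_lt t : r t < n.
  rewrite -cardT -cardsT; apply: proper_card; apply/properP; split.
    exact: subsetT.
  by exists t; rewrite ?inE ?ltnn.
have r_mono t u : key t < key u -> r t < r u.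
  move=> tu; apply: proper_card; apply/properP; split.
    by apply/subsetP => z; rewrite !inE => /ltn_trans ->.
  by exists t; rewrite ?inE ?ltnn.
have DE t u : (r t < r u) = (key t < key u).
  have [/r_mono // | /r_mono | /inj_key ->] := ltngtP (key t) (key u).
    by lia.
  by rewrite ltnn.
exists [ffun t => Ordinal (r_lt t)] => [t u | t u]; last by rewrite !ffunE /= DE.
rewrite !ffunE => -[rE]; apply: inj_key.
by have := DE t u; have := DE u t; rewrite rE ltnn; lia.
Qed.

End Ranks.

(** * Diamond labellings and their descents at the borders *)

Section Diamonds.
Set Implicit Arguments.
Unset Strict Implicit.
Local Open Scope nat_scope.
Variables n e : nat.
(** The greatest element of a diamond has index [n.+1], and [e] is the number of borders between
    consecutive diamonds. *)
Notation v := n.+2.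
Notation d := e.+1.
Implicit Types (D E : {ffun 'I_d * 'I_v -> 'I_(v * d)}) (S : {set 'I_e}).
Implicit Types (t u : 'I_d * 'I_v) (p q : nat).

Local Notation patterns := [:: [:: 1; 3; 2]; [:: 2; 1; 3]].

Definition pos (t : 'I_d * 'I_v) : nat := t.1 * v + t.2.

Lemma pos_lt t : pos t < d * v.
Proof.
case: t => k i; rewrite /pos /=.
by have := ltn_ord i; have := leq_mul (ltn_ord k) (leqnn v); rewrite mulSn; lia.
Qed.

Lemma pos_surj p : p < d * v -> exists t, p = pos t.
Proof.
move=> pdv; have pk : p %/ v < d by rewrite ltn_divLR.
exists (Ordinal pk, Ordinal (ltn_pmod p (isT : 0 < v))).
by rewrite /pos /= -divn_eq.
Qed.

Lemma pos_inj : injective pos.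
Proof.
move=> [k i] [l j]; rewrite /pos /= => eqp.
have := congr1 (divn^~ v) eqp; have := congr1 (modn^~ v) eqp.
rewrite !modnMDl !modn_small // !divnMDl // !divn_small // !addn0.
by move=> /ord_inj -> /ord_inj ->.
Qed.

Lemma size_diamond_word D : size (diamond_word D) = d * v.
Proof. by rewrite size_allpairs !size_enum_ord. Qed.

Lemma nth_diamond_word D t : nth 0 (diamond_word D) (pos t) = (D t).+1.
Proof.
case: t => k i; have := @nth_allpairs _ _ _ (fun k i => (val (D (k, i))).+1)
  k i 0 (enum 'I_d) (enum 'I_v) k i.
by rewrite !size_enum_ord !nth_ord_enum; apply.
Qed.

Lemma nth_diamond_word_inj D : injective D ->
  forall p q, p < d * v -> q < d * v ->
  nth 0 (diamond_word D) p = nth 0 (diamond_word D) q -> p = q.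
Proof.
move=> injD p q /pos_surj[t ->] /pos_surj[u ->].
by rewrite !nth_diamond_word => -[/ord_inj/injD ->].
Qed.

Lemma diamondsP D :
  reflect (injective D /\ forall k i j, diamond_lt i j -> D (k, i) < D (k, j))
          (D \in diamonds v d).
Proof.
rewrite inE; apply: (iffP andP) => -[/injectiveP injD h]; split=> //.
  by move=> k i j; move: h => /forallP/(_ k)/forallP/(_ i)/forallP/(_ j)/implyP.
by apply/'forall_forallP => k i; apply/forallP => j; apply/implyP; apply: h.
Qed.

Lemma diamonds_avoidingP D :
  reflect [/\ injective D, forall k i j, diamond_lt i j -> D (k, i) < D (k, j)
             & reverse_layered (d * v) (nth 0 (diamond_word D))]
          (D \in diamonds_avoiding v d patterns).
Proof.
rewrite inE -(size_diamond_word D).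
by apply: (iffP andP) => [[/diamondsP[? ?] /avoids_132_213P] |
  [? ? ?]]; split=> //; [apply/diamondsP | apply/avoids_132_213P].
Qed.

(* A descent between two middle elements would form 132 with the least element. *)
Lemma diamond_increasing D (k : 'I_d) (i j : 'I_v) :
  D \in diamonds_avoiding v d patterns -> j = i.+1 :> nat -> D (k, i) < D (k, j).
Proof.
case/diamonds_avoidingP => injD lt_D rl ji.
have [i0 | i_neq0] := eqVneq (val i) 0.
  by apply: lt_D; rewrite /diamond_lt -val_eqE /= ji i0.
have [jmax | j_neq] := eqVneq (val j) n.+1.
  by apply: lt_D; rewrite /diamond_lt -val_eqE /=; move: jmax => /=; lia.
have lt0j : D (k, ord0) < D (k, j).
  by apply: lt_D; rewrite /diamond_lt -val_eqE /= ji.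
have neq : D (k, i) <> D (k, j) :> nat.
  by move=> /val_inj/injD[] /(congr1 val) /=; lia.
have := rl (pos (k, ord0)) (pos (k, i)) (pos (k, j)).
rewrite !nth_diamond_word pos_lt !ltnS /pos /= !ltn_add2l ji.
by move: (i_neq0) => /=; rewrite -lt0n => -> /(_ isT (ltnSn _) isT); lia.
Qed.

(** Border [k] separates diamond [k], written [widen_ord _ k], from diamond [k.+1], written
    [lift ord0 k]. *)
Definition border_descents D : {set 'I_e} :=
  [set k : 'I_e | D (lift ord0 k, ord0) < D (widen_ord (leqnSn e) k, ord_max)].

Lemma border_pos (k : 'I_e) :
  (k * v + n.+1 = pos (widen_ord (leqnSn e) k, ord_max)) *
  ((k * v + n.+1).+1 = pos (lift ord0 k, ord0)).
Proof. by split; rewrite // /pos /= /bump /= mulSn; lia. Qed.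

(** Either [p] is the last letter of a diamond, hence at a border, or [p] and [p.+1] lie in one
    diamond, where the labels increase. *)
Lemma diamond_word_descent D p :
  D \in diamonds_avoiding v d patterns -> p.+1 < d * v ->
  (nth 0 (diamond_word D) p.+1 < nth 0 (diamond_word D) p) =
  [exists k in border_descents D, p == k * v + n.+1].
Proof.
move=> hD p1; have [[k i] pE] := pos_surj (ltnW p1).
have [imax | i_neq] := eqVneq (val i) n.+1.
  (* A last letter with a successor is not in the last diamond, so [k] indexes a border. *)
  have ke : k < e.
    rewrite ltnNge; apply/negP => ek; move: p1; rewrite pE /pos /= imax.
    by have := leq_mul ek (leqnn v); rewrite mulSn; lia.
  pose l := Ordinal ke.
  have pl : p = l * v + n.+1 by rewrite pE /pos /= imax.
  transitivity (l \in border_descents D).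
    by rewrite pl !border_pos !nth_diamond_word inE ltnS.
  apply/idP/existsP => [lD | [k' /andP[k'D /eqP]]].
    by exists l; rewrite lD pl eqxx.
  rewrite pl => /addIn/eqP; rewrite eqn_mul2r /= => /eqP lk.
  by have -> : l = k' by apply: val_inj.
have i1 : i.+1 < v by have := ltn_ord i; move: i_neq => /=; lia.
have p1E : p.+1 = pos (k, Ordinal i1) by rewrite pE /pos /= addnS.
rewrite p1E {1}pE !nth_diamond_word ltnS.
transitivity false.
  by apply/negbTE; rewrite -leqNgt ltnW // diamond_increasing.
apply/esym/existsP => -[l /andP[_ /eqP]].
rewrite border_pos pE => /pos_inj[_ iE]; move: i_neq; rewrite iE /=; lia.
Qed.

(** The injection [k |-> k * v + n.+1] carries the border descents onto all descents of the word. *)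
Lemma des_diamond_word D : D \in diamonds_avoiding v d patterns ->
  des (diamond_word D) = #|border_descents D|.
Proof.
move=> hD; rewrite /des.
have f_lt (k : 'I_e) : k * v + n.+1 < (size (diamond_word D)).-1.
  rewrite size_diamond_word.
  by have := pos_lt (lift ord0 k, ord0); rewrite -border_pos; lia.
pose f k := Ordinal (f_lt k).
have f_inj : injective f.
  move=> k l /(congr1 val)/= /addIn/eqP; rewrite eqn_mul2r /= => /eqP.
  exact: ord_inj.
rewrite -(card_imset _ f_inj); apply: eq_card => p; rewrite inE.
rewrite diamond_word_descent //; last first.
  by have := ltn_ord p; have := size_diamond_word D; lia.
apply/existsP/imsetP => [[k /andP[kD /eqP pE]] | [k kD ->]]; exists k => //.
  exact: val_inj.
by rewrite kD eqxx.
Qed.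

Lemma card_labels : #|{: 'I_d * 'I_v}| = v * d.
Proof. by rewrite card_prod !card_ord mulnC. Qed.

(** Equal border descents give equal descents, hence the same relative order of the letters, hence
    the same ranks. *)
Lemma border_descents_inj :
  {in diamonds_avoiding v d patterns &, injective border_descents}.
Proof.
move=> D E hD hE bDE.
have [injD _ rlD] := diamonds_avoidingP _ hD.
have [injE _ rlE] := diamonds_avoidingP _ hE.
apply/ffunP; apply: (injective_same_order _ _ _ _ card_labels injD injE _) => t u.
have := @reverse_layered_same_order _ _ _ (nth_diamond_word_inj injD)
  (nth_diamond_word_inj injE) rlD rlE _ _ _ (pos_lt t) (pos_lt u).
rewrite !nth_diamond_word !ltnS; apply=> p p1.
by rewrite !diamond_word_descent // bDE.
Qed.

Lemma border_descents_surj S :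
  exists2 D, D \in diamonds_avoiding v d patterns & border_descents D = S.
Proof.
(* [c k] counts the borders of [S] to the left of diamond [k]; it is the index of the block
   containing that diamond. *)
pose c (k : nat) := #|[set s in S | s < k]|.
have c_mono k l : k <= l -> c k <= c l.
  move=> kl; apply: subset_leq_card; apply/subsetP => s.
  by rewrite !inE => /andP[-> /leq_trans ->].
(* This keeps the subtraction [e - c k] below from being truncated. *)
have c_le k : c k <= e by rewrite -[leqRHS]card_ord max_card.
have c_step (k : 'I_e) : (c k < c k.+1) = (k \in S).
  apply/idP/idP => [|kS]; last first.
    apply: proper_card; apply/properP; split; last first.
      by exists k; rewrite !inE kS /= ?ltnn.
    by apply/subsetP => s; rewrite !inE => /andP[-> /ltnW].
  apply: contraTT => kS; rewrite -leqNgt; apply: subset_leq_card.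
  apply/subsetP => s; rewrite !inE ltnS leq_eqVlt => /andP[sS].
  by case/predU1P=> [/val_inj sk | ->]; rewrite ?sS //; move: kS; rewrite -sk sS.
(* The blocks cut out by S are decreasing, the labels increase inside a block. *)
pose key t := (e - c t.1) * (d * v) + pos t.
(* Since [pos] stays below [d * v], keys compare lexicographically: later blocks are smaller, and
   ties are broken by position. *)
have key_lt t u : (key t < key u) =
    (c u.1 < c t.1) || (c u.1 == c t.1) && (pos t < pos u).
  rewrite /key; have := pos_lt t; have := pos_lt u; move: (d * v) => N uN tN.
  have := c_le t.1; have := c_le u.1; move: (c t.1) (c u.1) => a b ae be.
  have [ab | ab | <-] := ltngtP b a; last by rewrite /= ltn_add2l.
    have : (e - a).+1 * N <= (e - b) * N by apply: leq_mul => //; lia.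
    by rewrite mulSn /=; lia.
  have : (e - b).+1 * N <= (e - a) * N by apply: leq_mul => //; lia.
  by rewrite mulSn /=; lia.
have key_inj : injective key.
  move=> t u keyE; apply: pos_inj.
  by have := key_lt t u; have := key_lt u t; rewrite keyE ltnn; lia.
have [D injD D_lt] := rank_exists _ _ _ card_labels key_inj.
have pos_fst t u : pos t <= pos u -> t.1 <= u.1.
  by move=> /(leq_div2r v); rewrite /pos !divnMDl // !divn_small // !addn0.
exists D.
  apply/diamonds_avoidingP; split=> //.
    move=> k i j /andP[ij]; rewrite D_lt key_lt eqxx ltnn /= /pos ltn_add2l.
    move: ij; rewrite -val_eqE /=; have := ltn_ord i; have := ltn_ord j; lia.
  (* Both patterns have their first value below their third, which forces the outer two letters into
     one block. As [c] is monotone, the middle letter is there too, but labels increase within a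
     block. *)
  move=> p q r pq qr rn.
  have [w rE] := pos_surj rn; have [u qE] := pos_surj (ltn_trans qr rn).
  have [t pE] := pos_surj (ltn_trans pq (ltn_trans qr rn)); subst p q r.
  rewrite !nth_diamond_word !ltnS !D_lt !key_lt.
  have := c_mono _ _ (pos_fst _ _ (ltnW pq)).
  by have := c_mono _ _ (pos_fst _ _ (ltnW qr)); lia.
apply/setP => k; rewrite inE D_lt key_lt -c_step /= /bump /= add1n.
(* The letter after the border stands later in the word, so a descent there can only come from a
   change of block. *)
suff -> : (pos (lift ord0 k, ord0) < pos (widen_ord (leqnSn e) k, ord_max)) = false.
  by rewrite andbF orbF.
by rewrite -!border_pos; lia.
Qed.

Lemma sum_des_diamonds :
  (\sum_(D in diamonds_avoiding v d patterns) 'X^(des (diamond_word D)) =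
   (1 + 'X) ^+ e :> {poly int})%R.
Proof.
rewrite (eq_bigr (fun D => 'X^(#|border_descents D|)%R)); last first.
  by move=> D hD; rewrite des_diamond_word.
rewrite -(big_imset (fun S => 'X^(#|S|))%R border_descents_inj) /=.
rewrite (eq_bigl predT) => [|S]; last first.
  by have [D hD <-] := border_descents_surj S; rewrite imset_f.
(* Expanding [('X + 1) ^+ e] over the borders: choosing ['X] exactly at the borders in [S]
   contributes ['X^#|S|]. *)
rewrite addrC -[in RHS](card_ord e) -prodr_const bigA_distr.
apply: eq_bigr => S _; rewrite -prodr_const big_mkcond.
by apply: eq_bigr.
Qed.

End Diamonds.

(** * Coefficients of power series, and the generating function *)

Section PowerSeries.
Variable R : comUnitRingType.
Implicit Types (a : fps R) (r : R).

Lemma fcoefD a b k : fcoef (a + b) k = fcoef a k + fcoef b k.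
Proof. by []. Qed.

Lemma fcoefN a k : fcoef (- a) k = - fcoef a k.
Proof. by []. Qed.

Lemma fcoef1 k : fcoef (1 : fps R) k = (k == 0)%:R.
Proof. by case: k. Qed.

Lemma fcoefCM r a k : fcoef (fpsC r * a) k = r * fcoef a k.
Proof.
rewrite /= big_ord_recl /= subn0 big1 ?addr0 // => i _.
by rewrite mul0r.
Qed.

Lemma fcoefXM a k : fcoef (fpsX R * a) k = if k is j.+1 then fcoef a j else 0.
Proof.
case: k => [|k]; first by rewrite /= big_ord1 mul0r.
rewrite /= big_ord_recl mul0r add0r big_ord_recl mul1r subSS subn0 big1 ?addr0 //.
by move=> i _; rewrite mul0r.
Qed.

End PowerSeries.

Theorem theorem3p2 (v : nat) (hv : (4 <= v)%N) :
  let x : fps {poly int} := fpsC 'X in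
  let y : fps {poly int} := fpsX _ in
  1 + Fps (fun d => if (1 <= d)%N then
             \sum_(D in diamonds_avoiding v d [:: [:: 1; 3; 2]; [:: 2; 1; 3]]%N)
                'X^(des (diamond_word D))
           else 0)
  = (1 - y * x) / (1 - y * (1 + x)).
Proof.
move=> x y; case: v hv => [|[|n]] // _.
(* [G] is the geometric series inverse to [1 - y * (1 + x)]; the factor [y] in [y * G] accounts for
   the exponent [d - 1]. *)
pose G : fps {poly int} := Fps (fun k => (1 + 'X) ^+ k).
have -> : Fps (fun d => if (1 <= d)%N then
    \sum_(D in diamonds_avoiding n.+2 d [:: [:: 1; 3; 2]; [:: 2; 1; 3]]%N)
      'X^(des (diamond_word D)) else 0) = y * G.
  apply/fpsP => -[|e]; rewrite fcoefXM //=; exact: sum_des_diamonds.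
have GE : (1 - y * (1 + x)) * G = 1.
  apply/fpsP => k; rewrite mulrBl mul1r -mulrA mulrDl mul1r fcoefD fcoefN fcoefXM.
  case: k => [|k]; first by rewrite subr0.
  by rewrite fcoefD fcoefCM fcoef1 /= exprS mulrDl mul1r subrr.
have Ud : 1 - y * (1 + x) \is a GRing.unit by apply/unitrPr; exists G.
(* After clearing the denominator, the left side is [(1 - y * (1 + x)) + y], that is [1 - y * x]. *)
apply: (mulIr Ud); rewrite divrK // mulrDl mul1r -mulrA [G * _]mulrC GE mulr1.
by rewrite mulrDr mulr1 opprD addrA addrAC subrK.
Qed.
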